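(* Let $F\in\mathcal{A}$ and let $\mu$ satisfy $\mathrm{E}(F)<\mu<0$. With $h(\nu)=\mathrm{E}_F[\log(1-(X-\mu)\nu)]$ (which depends on $F$ and $\mu$), the following hold. (i) $$D_{\min}(F,\mu)=\max_{0\le\nu\le -1/\mu}h(\nu),$$ and the optimal solution $\nu^*=\operatorname{argmax}_{0\le\nu\le -1/\mu}h(\nu)$ is unique. In particular, if $\mathrm{E}_F[\mu/X]\le 1$, then $\nu^*=-1/\mu$ and $$D_{\min}(F,\mu)=h(-1/\mu)=\sum_{i=2}^M f_i\log(x_i/\mu).$$ If instead $\mathrm{E}_F[\mu/X]\ge 1$, then $D_{\min}(F,\mu)$ is the value of the unconstrained problem $$D_{\min}(F,\mu)=\max_{\nu}h(\nu).$$ (ii) $$\nu^*\ge\frac{\mu-\mathrm{E}(F)}{-\mu(1+\mu)}.$$ (iii) As a function of $\mu$, $D_{\min}(F,\mu)$ is differentiable on $(\mathrm{E}(F),0)$, with $$\frac{\partial}{\partial\mu}D_{\min}(F,\mu)=\nu^*,$$ where $\nu^*=\nu^*(F,\mu)$ is as in (i).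
   Context: $\mathcal{A}$ is the family of probability distributions $F$ on $\mathbb{R}$ whose support $\mathrm{supp}(F)$ is a finite subset of $[-1,0]$. $\mathrm{E}(F)$ is the mean of $F$; $\mathrm{E}_F[\cdot]$ is expectation when the random variable $X$ has distribution $F$. The Kullback-Leibler divergence is $D(F\|G)=\mathrm{E}_F[\log\frac{\mathrm{d}F}{\mathrm{d}G}]$ if $\frac{\mathrm{d}F}{\mathrm{d}G}$ exists and $+\infty$ otherwise, and $$D_{\min}(F,\mu)=\min_{G\in\mathcal{A}:\,\mathrm{E}(G)\ge\mu}D(F\|G).$$ Write $\{0\}\cup\mathrm{supp}(F)=\{x_1,\dots,x_M\}$ with distinct $x_i$, $x_1=0$ and $x_i<0$ for $i>1$, and $f_i=F(\{x_i\})$ (so $f_1$ may be $0$). Thus $h(\nu)=\sum_{i=1}^M f_i\log(1-(x_i-\mu)\nu)$. Conventions: $0\log 0=0$; terms with $f_i=0$ contribute $0$ to $h(\nu)$; $\log y=-\infty$ for $y\le 0$ (so $h(\nu)=-\infty$ if $1-(x_i-\mu)\nu\le 0$ for some $i$ with $f_i>0$, and the unconstrained maximum is over all $\nu\in\mathbb{R}$ with this convention). $\mathrm{E}_F[\mu/X]$ is defined to be $\infty$ if $F(\{0\})=f_1>0$. *)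

(* Defs.v *)
From HB Require Import structures.
From mathcomp Require Import all_boot all_order all_algebra.
From mathcomp Require Import all_classical all_reals all_analysis.

Set Implicit Arguments.
Unset Strict Implicit.
Unset Printing Implicit Defensive.

Import Order.TTheory GRing.Theory Num.Theory.
Import numFieldNormedType.Exports.

Local Open Scope classical_set_scope.
Local Open Scope ring_scope.
Local Open Scope charge_scope.

Section definitions.
Context {R : realType}.

Definition dist := probability (measurableTypeR R) R.

Implicit Types (F G : dist) (mu nu : R).

Definition supp F : set R :=
  [set x | forall U : set R, open_nbhs x U -> (0 < F U)%E].

Definition calA : set dist :=
  [set F | finite_set (supp F) /\ supp F `<=` `[-1, 0]].

Definition mean F : \bar R := ('E_F[fun x : R => x])%E.

(* [lne] extends [ln] to \bar R by -oo on nonpositive arguments.  The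
   conventions 0 log 0 = 0 of [KL] and [h] hold since F-null sets do not
   contribute to integrals with respect to F. *)
Definition KL F G : \bar R :=
  if pselect (F `<< G) then
    (\int[F]_x lne (('d (charge_of_finite_measure F) '/d G) x))%E
  else +oo%E.

(* Total as an infimum; attainment is not built into the definition. *)
Definition Dmin F mu : \bar R :=
  ereal_inf [set KL F G | G in [set G | calA G /\ (mu%:E <= mean G)%E]].

Definition h F mu nu : \bar R :=
  (\int[F]_x lne (1 - (x - mu) * nu)%:E)%E.

Definition mean_inv F mu : \bar R :=
  if (0 < F [set 0%R])%E then +oo%E else ('E_F[fun x : R => (mu / x)%R])%E.

Definition is_argmax (D : set R) (f : R -> \bar R) (nu : R) : Prop :=
  D nu /\ forall nu', D nu' -> (f nu' <= f nu)%E.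

End definitions.

Arguments dist R : clear implicits.

(* Main.v *)
Require Import Defs.
From HB Require Import structures.
From mathcomp Require Import all_boot all_order all_algebra.
From mathcomp Require Import all_classical all_reals all_analysis.
From mathcomp Require Import measurable_realfun.
From mathcomp Require finmap.
From mathcomp Require Import ring lra.

Set Implicit Arguments.
Unset Strict Implicit.
Unset Printing Implicit Defensive.

Import Order.TTheory GRing.Theory Num.Theory.
Import numFieldNormedType.Exports.

Local Open Scope classical_set_scope.
Local Open Scope ring_scope.

(** A law in [calA] is determined by its finitely many atoms, so all integrals
    in the statement are finite sums over the atoms of [F].  Put
    w(x) = 1 - (x - mu) nu, so that the dual objective is
    h(nu) = sum_x F{x} ln w(x), a concave function with derivative
    H(nu) = sum_x F{x} (mu - x) / w(x)  ([slope]).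

    The proof revolves around one point nu: a solution of the optimality
    conditions of maximizing h over [0, -1/mu], namely H(nu) >= 0 and
    H(nu) (1 + mu nu) = 0 ([dual_critical]).  It exists by the intermediate
    value theorem ([critical_exists]): H(0) = mu - E(F) > 0, and H either
    becomes nonpositive before -1/mu or stays nonnegative up to -1/mu.

    At such a point everything follows from ln t <= t - 1.
    - Applied to w'(x) / w(x), it gives h(nu') <= h(nu) + H(nu) (nu' - nu),
      strictly for nu' <> nu because F charges a point other than mu; hence nu
      is the only maximizer on [0, -1/mu], and a global one when H(nu) = 0,
      which E[mu/X] >= 1 forces.
    - Applied to w(x) G{x} / F{x}, it gives weak duality
      KL F G >= h(nu) + nu (E(G) - mu) for every law G on [-1, 0]
      ([KL_dual_bound]).
    - Conversely, the measure with masses F{x} / w(x), completed by an atom of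
      mass nu H(nu) at 0, is a probability Q with mean mu and
      KL F Q = h(nu).  The tilted measure (1 + t (x - mu)) dQ has mean
      mu + t Var(Q), and its divergence exceeds h(nu) by at most
      nu (m - mu) + 2 t^2, where m is its mean and |t| <= 1/2
      ([KL_primal_bound]).
    Since nu Var(Q) = mu - E(F), the parameter t is proportional to m - mu, so
    the last two items enclose Dmin F m between the line
    h(nu) + nu (m - mu) and that line plus O((m - mu)^2).  This yields the value
    of the minimum, its attainment, and the derivative nu in mu, without having
    to know how the maximizer varies with mu.

    Claim (ii) is nu Var(Q) = mu - E(F) combined with the bound
    Var(Q) <= - mu (1 + mu) for a law on [-1, 0] with mean mu. *)

(** * Integrals against a finitely supported law *)

(** No integrability is needed, since the integral over a disjoint union of two
    sets is the sum of the integrals, and [-oo] absorbs in [\bar R]; this is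
    what allows [h] to take the value [-oo]. *)
Lemma integral_seq (R : realType) (P : dist R) (s : seq R)
    (f : measurableTypeR R -> \bar R) :
  uniq s -> P (~` [set` s]) = 0%E -> measurable_fun setT f ->
  (\int[P]_x f x = \sum_(a <- s) P [set a] * f a)%E.
Proof.
move=> us Ps mf.
have ms (t : seq R) : measurable ([set` t] : set (measurableTypeR R)).
  exact/countable_measurable/finite_set_countable/finite_seq.
have mfS (A : set (measurableTypeR R)) : measurable_fun A f.
  exact: measurable_funS mf.
rewrite -(setUv [set` s]) integral_setU//; last 2 first.
- exact: measurableC.
- exact/disj_setPCl.
rewrite [X in (_ + X)%E]null_set_integral ?adde0//; last first.
  exact: measurableC.
elim: s us {Ps} => [_|a s IH /= /andP[as_ us]].
  by rewrite big_nil set_nil integral_set0.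
have -> : [set` a :: s] = [set a] `|` [set` s].
  by apply/seteqP; split=> x /=; rewrite in_cons; [move/predU1P|move=> ?; exact/predU1P].
rewrite big_cons integral_setU//; first last.
  by rewrite disj_set2E; apply/eqP/seteqP; split => // x [/= ->]; rewrite (negbTE as_).
rewrite IH//; congr (_ + _)%E.
transitivity (\int[P]_(x in [set a]) cst (f a) x)%E.
  by apply: eq_integral => x /[!inE] ->.
by rewrite integral_cst// muleC.
Qed.

Lemma measurable_lne (R : realType) :
  measurable_fun setT (fun r : R => lne r%:E).
Proof.
rewrite /=; apply: measurable_fun_ifT => //.
  by apply: measurable_fun_ler.
by apply/measurable_EFinP.
Qed.

Lemma not_in_supp (R : realType) (P : dist R) (x : R) :
  ~ supp P x -> exists2 U : set R, open_nbhs x U & P U = 0%E.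
Proof.
move=> /existsNP[U] /not_implyP[xU PU]; exists U => //.
by apply/eqP; rewrite eq_le measure_ge0 andbT leNgt; apply/negP.
Qed.

(** The complement of the support is covered by its null rational intervals, of
    which there are countably many. *)
Lemma supp_negligible (R : realType) (P : dist R) :
  @negligible _ (measurableTypeR R) R P (~` supp P).
Proof.
pose I (a : rat * rat) : set R := `]ratr a.1, ratr a.2[%classic.
pose J (n : nat) : set R := if unpickle n is Some a then
  (if P (I a) == 0%E then I a else set0) else set0.
suff sub : ~` supp P `<=` \bigcup_n J n.
  have nullS := @negligibleS _ (measurableTypeR R) R P _ _ sub.
  apply nullS; apply: negligible_bigcup => n; rewrite /J.
  case: unpickle => [a|]; last exact: negligible_set0.
  case: eqP => [Pa|_]; last exact: negligible_set0.
  by apply/negligibleP => //; exact: measurable_itv.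
move=> x /not_in_supp[U [oU Ux] PU].
have /nbhs_ballP[e /= e0 xeU] : nbhs x U by exact: open_nbhs_nbhs.
have [|q] := @rat_in_itvoo R (x - e) x; first by rewrite ltrBlDr ltrDl.
rewrite in_itv /= => /andP[xq qx].
have [|r] := @rat_in_itvoo R x (x + e); first by rewrite ltrDl.
rewrite in_itv /= => /andP[xr rx].
have IU : I (q, r) `<=` U.
  move=> y; rewrite /I /= in_itv /= => /andP[qy yr]; apply: xeU.
  by rewrite /ball /= ltr_norml; apply/andP; split; lra.
have PI : P (I (q, r)) == 0%E.
  rewrite eq_le measure_ge0 andbT -PU le_measure ?inE//.
    exact: measurable_itv.
  exact: open_measurable.
exists (pickle (q, r)); first by [].
by rewrite /J pickleK PI /I /= in_itv /= qx xr.
Qed.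

Lemma measurable_seq (R : realType) (s : seq R) :
  measurable ([set` s] : set (measurableTypeR R)).
Proof. exact/countable_measurable/finite_set_countable/finite_seq. Qed.

Section finite_support.
Variables (R : realType) (P : dist R).
Hypothesis Pfin : finite_set (supp P).

Definition atoms : seq R := finmap.enum_fset (fset_set (supp P)).

Lemma atomsP x : reflect (supp P x) (x \in atoms).
Proof. by rewrite /atoms in_fset_set// ; apply: (iffP idP); rewrite inE. Qed.

Lemma set_atoms : [set` atoms] = supp P.
Proof. exact: fset_setK. Qed.

Lemma supp_full : P (~` supp P) = 0%E.
Proof.
apply/negligibleP; last exact: supp_negligible.
by apply: measurableC; rewrite -set_atoms; exact: measurable_seq.
Qed.

(** A point of a finite support is isolated in it: the complement of the other
    points is a neighborhood, of positive mass, and it differs from the point by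
    a null set. *)
Lemma atom_gt0 x : x \in atoms -> (0 < P [set x])%E.
Proof.
move=> /atomsP Px.
have xU : open_nbhs x (~` (supp P `\ x)).
  split; last by case=> _; apply.
  apply: closed_openC.
  move: (supp P `\ x) (sub_finite_set (@subDsetl _ (supp P) [set x]) Pfin).
  apply/accessible_finite_set_closed/hausdorff_accessible; exact: Rhausdorff.
apply: lt_le_trans (Px _ xU) _.
have mS : measurable (~` supp P : set (measurableTypeR R)).
  by rewrite -set_atoms; apply: measurableC; exact: measurable_seq.
rewrite setCD setUC; apply: le_trans (measureU2 _ _ _) _ => //=.
by rewrite supp_full adde0.
Qed.

Lemma integral_atoms (f : R -> \bar R) : measurable_fun setT f ->
  (\int[P]_x f x = \sum_(a <- atoms) P [set a] * f a)%E.
Proof.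
by apply: integral_seq; [exact: finmap.fset_uniq|rewrite set_atoms supp_full].
Qed.

End finite_support.

Lemma gt0_supp (R : realType) (P : dist R) (x : R) :
  (0 < P [set x])%E -> supp P x.
Proof.
move=> Px U [oU Ux]; apply: lt_le_trans Px _.
rewrite le_measure ?inE//; first exact: open_measurable.
by move=> _ ->.
Qed.

Lemma uniq_atoms (R : realType) (P : dist R) : uniq (atoms P).
Proof. exact: finmap.fset_uniq. Qed.

(** * The concave dual objective of a finite law *)

Lemma ln_le_sub1 (R : realType) (t : R) : 0 < t -> ln t <= t - 1.
Proof.
move=> t0; have := @le_ln1Dx R (t - 1); rewrite [1 + _]addrC subrK; apply.
by rewrite ltrBrDl subrr.
Qed.

Lemma ln_lt_sub1 (R : realType) (t : R) : 0 < t -> t != 1 -> ln t < t - 1.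
Proof.
move=> t0 t1; have lnt : ln t != 0 by rewrite ln_eq0.
have := @expR_gt1Dx R (ln t) lnt; rewrite lnK ?posrE//.
by rewrite -ltrBrDl.
Qed.

Definition tilt (R : realType) (mu nu x : R) : R := 1 - (x - mu) * nu.

(** The derivative of [dual_value] in [nu]. *)
Definition slope (R : realType) (s : seq R) (p : R -> R) (mu nu : R) : R :=
  \sum_(x <- s) p x * (mu - x) / tilt mu nu x.

Definition dual_value (R : realType) (s : seq R) (p : R -> R) (mu nu : R) : R :=
  \sum_(x <- s) p x * ln (tilt mu nu x).

(** The optimality conditions for maximizing [dual_value] over [0, -1/mu]:
    [1 + mu * nu] is the slack of the upper bound, and the derivative may only be
    positive where that slack vanishes.  For a law with mean below [mu] the slope at
    [nu = 0] is positive, so the lower bound contributes no multiplier. *)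
Definition dual_critical (R : realType) (s : seq R) (p : R -> R) (mu nu : R) :=
  [/\ 0 <= nu, 0 <= 1 + mu * nu, {in s, forall x, 0 < tilt mu nu x},
      0 <= slope s p mu nu & slope s p mu nu * (1 + mu * nu) = 0].

Section finite_law.
Variables (R : realType) (s : seq R) (p : R -> R) (mu : R).
Hypothesis p_gt0 : {in s, forall x, 0 < p x}.
Hypothesis p_sum1 : \sum_(x <- s) p x = 1.
Hypothesis s_itv : {in s, forall x, -1 <= x <= 0}.

Local Notation w nu := (tilt mu nu).
Local Notation H := (slope s p mu).

(** The measure with masses [p x / tilt mu nu x] has total mass at most 1 at a
    critical point; what is missing goes to an atom at 0. *)
Lemma tilted_mass nu : {in s, forall x, 0 < w nu x} ->
  \sum_(x <- s) p x / w nu x = 1 - nu * H nu.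
Proof.
move=> w0; rewrite -p_sum1 /slope mulr_sumr -sumrB; apply: eq_big_seq => x xs.
have := w0 x xs; rewrite /tilt => /lt0r_neq0 ?; by field.
Qed.

(** At a critical point the tilted measure, completed by an atom of mass
    [nu * slope] at 0, has mean [mu].  That atom adds [nu * slope * mu ^+ 2] to the
    second moment, which complementarity turns into [slope / nu], so that [nu] times
    the variance is [mu] minus the mean of [p]. *)
Lemma tilted_second_moment nu : {in s, forall x, 0 < w nu x} ->
  nu * \sum_(x <- s) p x / w nu x * (mu - x) ^+ 2 =
  mu - \sum_(x <- s) p x * x - H nu.
Proof.
move=> w0; rewrite -[X in X - _ - _]mulr1 -p_sum1 !mulr_sumr /slope -!sumrB.
apply: eq_big_seq => x xs.
have := w0 x xs; rewrite /tilt => /lt0r_neq0 ?; by field.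
Qed.

Let ratio_sum nu nu' : {in s, forall x, 0 < w nu x} ->
  \sum_(x <- s) p x * (w nu' x / w nu x - 1) = H nu * (nu' - nu).
Proof.
move=> w0; rewrite /slope mulr_suml; apply: eq_big_seq => x xs.
have := w0 x xs; rewrite /tilt => /lt0r_neq0 ?; by field.
Qed.

Let ln_ratio nu nu' x : 0 < w nu x -> 0 < w nu' x ->
  ln (w nu' x) - ln (w nu x) = ln (w nu' x / w nu x).
Proof. by move=> ? ?; rewrite ln_div ?posrE. Qed.

(** Concavity of the dual objective, in the form [ln t <= t - 1] applied to the
    ratio of the two tilts. *)
Lemma dual_value_tangent nu nu' :
  {in s, forall x, 0 < w nu x} -> {in s, forall x, 0 < w nu' x} ->
  dual_value s p mu nu' <= dual_value s p mu nu + H nu * (nu' - nu).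
Proof.
move=> w0 w0'; rewrite -lerBlDl /dual_value -sumrB -ratio_sum//.
rewrite big_seq [leRHS]big_seq; apply: ler_sum => x xs.
rewrite -mulrBr ler_wpM2l ?(ltW (p_gt0 xs))// ln_ratio ?w0 ?w0'//.
by rewrite ln_le_sub1// divr_gt0 ?w0 ?w0'.
Qed.

Lemma dual_value_strict nu nu' x0 : x0 \in s -> x0 != mu -> nu' != nu ->
  {in s, forall x, 0 < w nu x} -> {in s, forall x, 0 < w nu' x} ->
  dual_value s p mu nu' < dual_value s p mu nu + H nu * (nu' - nu).
Proof.
move=> x0s x0mu nn w0 w0'; rewrite -ltrBlDl /dual_value -sumrB -ratio_sum//.
rewrite (big_rem x0)//= [ltRHS](big_rem x0)//=; apply: ltr_leD.
  rewrite -mulrBr ltr_pM2l ?p_gt0// ln_ratio ?w0 ?w0'//.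
  rewrite ln_lt_sub1 ?divr_gt0 ?w0 ?w0'//.
  apply: contra nn => /eqP/divr1_eq; rewrite /tilt => /addrI/oppr_inj.
  by move/(mulfI _); rewrite subr_eq0 => /(_ x0mu)->.
rewrite big_seq [leRHS]big_seq; apply: ler_sum => x /mem_rem xs.
rewrite -mulrBr ler_wpM2l ?(ltW (p_gt0 xs))// ln_ratio ?w0 ?w0'//.
by rewrite ln_le_sub1// divr_gt0 ?w0 ?w0'.
Qed.

(** The Bhatia-Davis bound on the variance of a law on [-1, 0] with mean [mu],
    summed atom by atom from [(x + 1) * x <= 0]. *)
Lemma critical_lower_bound nu : dual_critical s p mu nu ->
  mu - \sum_(x <- s) p x * x <= nu * (- mu * (1 + mu)).
Proof.
move=> [nu0 _ w0 H0 Hmu].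
pose Q := \sum_(x <- s) p x / w nu x * (mu - x) ^+ 2.
have Qle : Q <= (1 + 2 * mu) * H nu - mu * (1 + mu) * (1 - nu * H nu).
  rewrite -tilted_mass// /slope !mulr_sumr -sumrB /Q big_seq [leRHS]big_seq.
  apply: ler_sum => x xs.
  have gx : 0 < p x / w nu x by rewrite divr_gt0 ?p_gt0 ?w0.
  have /andP[x1 x2] := s_itv xs.
  have -> : (1 + 2 * mu) * (p x * (mu - x) / w nu x) -
    mu * (1 + mu) * (p x / w nu x) =
    p x / w nu x * ((1 + 2 * mu) * (mu - x) - mu * (1 + mu)) by ring.
  rewrite ler_pM2l//; nra.
have := ler_wpM2l nu0 Qle; rewrite /Q tilted_second_moment// => dle.
(* the excess of the bound is the complementarity product times a factor *)
have HE : H nu * (1 + mu * nu) * (1 + nu * (1 + mu)) = 0 by rewrite Hmu mul0r.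
lra.
Qed.

End finite_law.

(** * Existence of a critical multiplier *)

Section critical_point.
Variables (R : realType) (s : seq R) (p : R -> R) (mu : R).
Hypothesis p_gt0 : {in s, forall x, 0 < p x}.
Hypothesis p_sum1 : \sum_(x <- s) p x = 1.
Hypothesis s_itv : {in s, forall x, -1 <= x <= 0}.
Hypothesis mean_lt : \sum_(x <- s) p x * x < mu.
Hypothesis mu_lt0 : mu < 0.

Local Notation w nu := (tilt mu nu).
Local Notation H := (slope s p mu).

Lemma slope0 : H 0 = mu - \sum_(x <- s) p x * x.
Proof.
rewrite -[X in X - _]mulr1 -p_sum1 mulr_sumr -sumrB; apply: eq_bigr => x _.
by rewrite /tilt mulr0 subr0 divr1 mulrBr mulrC.
Qed.

Lemma slope_continuous nu : {in s, forall x, 0 < w nu x} ->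
  {for nu, continuous H}.
Proof.
move=> w0; rewrite /prop_for /continuous_at /slope.
under eq_cvg do rewrite big_seq.
rewrite big_seq; apply: cvg_big => [|x xs]; first exact: add_continuous.
apply: cvgM; first exact: cvg_cst.
apply: cvgV; first by rewrite gt_eqF ?w0.
apply: cvgB; first exact: cvg_cst.
by apply: cvgM; [exact: cvg_cst|exact: cvg_id].
Qed.

(** The right end of the search interval.  Without an atom at 0 all tilts stay
    positive up to [-1/mu].  An atom at 0 makes the slope tend to [-oo] there, so
    the interval has to stop earlier: since [b * (mu - x) <= tilt mu b x], each
    atom other than 0 contributes at most its mass to [b * slope], and
    [b = (1 - p 0) / - mu] is where the contribution of 0 compensates this. *)
Lemma slope_endpoint : exists b,
  [/\ 0 <= b, 0 <= 1 + mu * b, {in s, forall x, 0 < w b x} &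
      H b <= 0 \/ 1 + mu * b = 0].
Proof.
have [s0|s0] := boolP (0 \in s); last first.
  exists (- mu^-1); have E : 1 + mu * - mu^-1 = 0.
    by rewrite mulrN divff ?subrr ?lt_eqF.
  split; [by rewrite oppr_ge0 invr_le0 ltW|by rewrite E| |by right].
  move=> x xs; have /andP[_ x0] := s_itv xs.
  have {}x0 : x < 0 by rewrite lt_neqAle x0 andbT; apply: contraNneq s0 => <-.
  have -> : w (- mu^-1) x = x * mu^-1 by rewrite /tilt; field; rewrite lt_eqF.
  by rewrite nmulr_rgt0// invr_lt0.
have q1 : p 0 + \sum_(x <- rem 0 s) p x = 1 by rewrite -p_sum1 [RHS](big_rem 0).
have p01 : p 0 < 1.
  have : - \sum_(x <- rem 0 s) p x <= \sum_(x <- s) p x * x.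
    rewrite [leRHS](big_rem 0)//= mulr0 add0r -sumrN big_seq [leRHS]big_seq.
    apply: ler_sum => x /mem_rem xs; have /andP[x1 _] := s_itv xs.
    by have := p_gt0 xs; nra.
  by move: q1 mean_lt mu_lt0; lra.
pose b := (1 - p 0) / - mu.
have b0 : 0 < b by rewrite divr_gt0 ?subr_gt0 ?oppr_gt0.
have bE : 1 + mu * b = p 0 by rewrite /b; field; rewrite lt_eqF.
have p00 := p_gt0 s0.
have wb : {in s, forall x, 0 < w b x}.
  by move=> x xs; have /andP[_ ?] := s_itv xs; rewrite /tilt; nra.
exists b; split; [exact: ltW|by rewrite bE; exact: ltW|exact: wb|left].
rewrite -(pmulr_rle0 _ b0) /slope (big_rem 0)//= mulrDr.
have -> : b * (p 0 * (mu - 0) / w b 0) = - (1 - p 0).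
  have -> : w b 0 = p 0 by rewrite /tilt -bE; ring.
  by rewrite /b; field; rewrite (gt_eqF p00) (lt_eqF mu_lt0).
have -> : 1 - p 0 = \sum_(x <- rem 0 s) p x by rewrite -q1; ring.
rewrite addrC subr_le0 mulr_sumr big_seq [leRHS]big_seq; apply: ler_sum.
move=> x /mem_rem xs; have wx := wb x xs; have px := p_gt0 xs.
rewrite mulrA ler_pdivrMr// /tilt; nra.
Qed.

(** Either the slope is still nonnegative at the endpoint, which is then critical,
    or it vanishes in between. *)
Lemma critical_exists : exists nu, dual_critical s p mu nu.
Proof.
have [b [b0 mub wb HbE]] := slope_endpoint.
have [Hb|Hb] := lerP 0 (H b).
  exists b; split=> //; case: HbE => [Hb'|->]; last by rewrite mulr0.
  by rewrite (_ : H b = 0) ?mul0r//; apply/eqP; rewrite eq_le Hb Hb'.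
(* tilts are affine in the multiplier and equal 1 at 0 *)
have wc c : 0 <= c <= b -> {in s, forall x, 0 < w c x}.
  move=> /andP[c0 cb] x xs; have := wb x xs; rewrite /tilt => ?.
  by have [?|?] := lerP (x - mu) 0; nra.
have [| |c] := @IVT R H 0 b 0 b0.
- apply: continuous_in_subspaceT => c; rewrite inE /= in_itv /= => cb.
  exact/slope_continuous/wc.
- by rewrite ge_min le_max (ltW Hb) orbT slope0 subr_ge0 (ltW mean_lt).
rewrite in_itv /= => cb Hc; exists c; have /andP[c0 cb'] := cb.
split=> //; [|exact: wc|by rewrite Hc|by rewrite Hc mul0r].
by apply: le_trans mub _; rewrite lerD2l ler_wnM2l// ltW.
Qed.

End critical_point.

(** * Means, divergences and dual values as finite sums *)

Definition mass (R : realType) (P : dist R) (x : R) : R := fine (P [set x]).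

Lemma massE (R : realType) (P : dist R) (x : R) : P [set x] = (mass P x)%:E.
Proof. by rewrite /mass fineK// fin_num_measure. Qed.

Section finite_support_integrals.
Variables (R : realType) (P : dist R).
Hypothesis Pfin : finite_set (supp P).

Lemma mass_gt0 : {in atoms P, forall x, 0 < mass P x}.
Proof. by move=> x /(atom_gt0 Pfin); rewrite massE. Qed.

Lemma integral_mass (f : R -> R) :
  measurable_fun setT f ->
  (\int[P]_x (f x)%:E = (\sum_(x <- atoms P) mass P x * f x)%:E)%E.
Proof.
move=> mf; rewrite (integral_atoms Pfin); last exact/measurable_EFinP.
by rewrite -sumEFin; apply: eq_bigr => x _; rewrite massE.
Qed.

Lemma mass_sum1 : \sum_(x <- atoms P) mass P x = 1.
Proof.
apply: EFin_inj; rewrite -(probability_setT P) -[RHS]mul1e -integral_cst//.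
have := @integral_mass (cst 1) (measurable_cst _); rewrite /= => ->.
by congr EFin; apply: eq_bigr => x _; rewrite mulr1.
Qed.

Lemma mean_mass : mean P = (\sum_(x <- atoms P) mass P x * x)%:E.
Proof. by rewrite /mean unlock integral_mass. Qed.

Lemma integral_lne_mass (f : R -> R) : measurable_fun setT f ->
  {in atoms P, forall x, 0 < f x} ->
  (\int[P]_x lne (f x)%:E = (\sum_(x <- atoms P) mass P x * ln (f x))%:E)%E.
Proof.
move=> mf f0; rewrite (integral_atoms Pfin); last first.
  exact: (measurableT_comp (@measurable_lne R) mf).
rewrite -sumEFin; apply: eq_big_seq => x xP.
by rewrite massE lne_EFin ?f0.
Qed.

Lemma integral_lne_Ny (f : R -> R) : measurable_fun setT f ->
  (exists2 x, x \in atoms P & f x <= 0) ->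
  (\int[P]_x lne (f x)%:E = -oo)%E.
Proof.
move=> mf [x xP fx]; rewrite (integral_atoms Pfin); last first.
  exact: (measurableT_comp (@measurable_lne R) mf).
rewrite (big_rem x)//= fx gt0_muleNy ?atom_gt0//.
Qed.

Lemma measurable_tilt (mu nu : R) : measurable_fun setT (tilt mu nu).
Proof.
apply: measurable_funB; first exact: measurable_cst.
apply: measurable_funM; last exact: measurable_cst.
by apply: measurable_funB => //; exact: measurable_cst.
Qed.

Lemma h_mass (mu nu : R) : {in atoms P, forall x, 0 < tilt mu nu x} ->
  h P mu nu = (dual_value (atoms P) (mass P) mu nu)%:E.
Proof. exact: (integral_lne_mass (measurable_tilt mu nu)). Qed.

(** One atom outside the domain of [ln] suffices, because it has positive mass. *)
Lemma h_Ny (mu nu : R) : ~ {in atoms P, forall x, 0 < tilt mu nu x} ->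
  h P mu nu = -oo%E.
Proof.
move=> w0; apply: (integral_lne_Ny (measurable_tilt mu nu)).
apply: contrapT => nex; apply: w0 => x xP; rewrite ltNge; apply/negP => wx.
by apply: nex; exists x.
Qed.

Lemma dominates_mass (G : dist R) : {in atoms P, forall x, 0 < mass G x} ->
  P `<< G.
Proof.
move=> G0; apply/null_content_dominatesP => A mA GA0.
have As : A `<=` ~` supp P.
  move=> x Ax /(atomsP Pfin) /G0; rewrite -lte_fin -massE ltNge => /negP; apply.
  by apply: (@le_trans _ _ (G A)); [rewrite le_measure ?inE// => _ ->|rewrite GA0].
apply/eqP; rewrite eq_le measure_ge0 andbT -(supp_full Pfin) le_measure ?inE//.
by rewrite -(set_atoms Pfin); apply: measurableC; exact: measurable_seq.
Qed.

(** The Radon-Nikodym derivative is only determined up to null sets, but integrating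
    it over an atom of [F] pins down its value there. *)
Lemma KL_mass (G : dist R) : P `<< G ->
  {in atoms P, forall x, 0 < mass G x} /\
  KL P G = (\sum_(x <- atoms P) mass P x * ln (mass P x / mass G x))%:E.
Proof.
move=> PG.
have G0 : {in atoms P, forall x, 0 < mass G x}.
  move=> x xP; rewrite lt_neqAle fine_ge0// andbT eq_sym.
  apply: contraTneq (mass_gt0 xP) => Gx.
  have /null_content_dominatesP/(_ _ (measurable_set1 x)) := PG.
  by rewrite /= massE Gx => /(_ erefl) Px; rewrite /mass Px ltxx.
split=> //.
pose f : R -> \bar R := Radon_Nikodym (charge_of_finite_measure P) G.
have fE x : f x = (fine (f x))%:E.
  by rewrite fineK//; exact: Radon_Nikodym_fin_num.
have fx : {in atoms P, forall x, fine (f x) = mass P x / mass G x}.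
  move=> x xP.
  have : P [set x] = (\int[G]_(y in [set x]) f y)%E.
    exact: (@Radon_Nikodym_integral _ _ _ (charge_of_finite_measure P) _ _ PG
      (measurable_set1 x)).
  have -> : (\int[G]_(y in [set x]) f y = \int[G]_(y in [set x]) cst (f x) y)%E.
    by apply: eq_integral => y /[!inE] ->.
  rewrite integral_cst// fE [X in (_ * X)%E]massE massE -EFinM => -[->].
  by rewrite mulfK// gt_eqF ?G0.
rewrite /KL; case: pselect => [PG'|//].
transitivity (\int[P]_x lne (fine (f x))%:E)%E.
  by apply: eq_integral => x _; rewrite -fE.
rewrite integral_lne_mass//.
- congr EFin; apply: eq_big_seq => x xP; by rewrite fx.
- apply/measurable_EFinP; rewrite (_ : EFin \o _ = f); last exact/funext.
  have := @Radon_Nikodym_integrable _ _ _ (charge_of_finite_measure P) _ PG.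
  by case/integrableP.
- by move=> x xP; rewrite fx// divr_gt0 ?mass_gt0 ?G0.
Qed.

End finite_support_integrals.

(** * Weak duality *)

Lemma sum_sub_uniq (V : nmodType) (T : eqType) (s t : seq T) (f : T -> V) :
  uniq s -> uniq t -> {subset s <= t} ->
  \sum_(x <- t | x \in s) f x = \sum_(x <- s) f x.
Proof.
move=> us ut st; rewrite -big_filter; apply: perm_big.
apply: uniq_perm => //; first exact: filter_uniq.
move=> x; rewrite mem_filter; apply/andP/idP => [[]//|xs].
by split=> //; exact: st.
Qed.

Lemma calA_atoms (R : realType) (P : dist R) : calA P ->
  {in atoms P, forall x, -1 <= x <= 0}.
Proof.
by move=> [Pfin PI] x /(atomsP Pfin)/PI; rewrite /= in_itv.
Qed.

(** The inequality [ln t <= t - 1] at [t = tilt * G{x} / F{x}] bounds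
    [dual_value - KL F G] by [E_G[tilt] - 1 = nu * (mu - E(G))].  Atoms of [G] that
    [F] does not charge only help, as [tilt >= 0] on [-1, 0]. *)
Lemma KL_dual_bound (R : realType) (F G : dist R) (mu nu : R) :
  calA F -> calA G -> 0 <= nu -> 0 <= 1 + mu * nu ->
  {in atoms F, forall x, 0 < tilt mu nu x} ->
  ((dual_value (atoms F) (mass F) mu nu + nu * (fine (mean G) - mu))%:E
     <= KL F G)%E.
Proof.
move=> FA GA nu0 munu w0.
have [Ffin _] := FA; have [Gfin _] := GA.
have [FG|FG] := pselect (F `<< G); last first.
  by rewrite /KL; case: pselect => [/FG//|nFG] /=; rewrite leey.
have [G0 ->] := KL_mass Ffin FG.
rewrite lee_fin -lerBrDl /dual_value -sumrB.
have sFG : {subset atoms F <= atoms G}.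
  by move=> x /G0 Gx; apply/(atomsP Gfin)/gt0_supp; rewrite massE lte_fin.
rewrite -[leRHS]opprK -[leLHS]opprK lerN2 -sumrN.
apply: (@le_trans _ _ (\sum_(x <- atoms F) (mass G x * tilt mu nu x - mass F x))).
  rewrite big_seq [leRHS]big_seq; apply: ler_sum => x xF.
  have px := mass_gt0 Ffin xF; have qx := G0 _ xF; have wx := w0 _ xF.
  rewrite opprB -mulrBr -[leRHS]divr1.
  rewrite -ln_div ?posrE ?divr_gt0//.
  have -> : mass G x * tilt mu nu x - mass F x = mass F x *
    (tilt mu nu x / (mass F x / mass G x) - 1).
    by field; rewrite !gt_eqF.
  by rewrite divr1 ler_pM2l// ln_le_sub1// !divr_gt0.
rewrite sumrB mass_sum1//.
apply: (@le_trans _ _ (\sum_(x <- atoms G) mass G x * tilt mu nu x - 1)).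
  rewrite lerD2r -(sum_sub_uniq _ (uniq_atoms F) (uniq_atoms G) sFG).
  rewrite big_mkcond big_seq [leRHS]big_seq; apply: ler_sum => x xG.
  case: ifP => // _; rewrite mulr_ge0 ?(ltW (mass_gt0 Gfin xG))// /tilt.
  have /andP[_ x0] := calA_atoms GA xG; nra.
rewrite mean_mass//= -[X in _ - X](mass_sum1 Gfin) -sumrB mulrBr opprB.
rewrite -[X in X - _]mulr1 -{1}(mass_sum1 Gfin) !mulr_sumr -sumrB.
by apply: ler_sum => x _; rewrite /tilt le_eqVlt; apply/orP; left; apply/eqP; ring.
Qed.

(** * Competitors of prescribed mean *)

Lemma discrete_law (R : realType) (s : seq R) (c : R -> R) :
  uniq s -> {in s, forall x, 0 <= c x} -> \sum_(x <- s) c x = 1 ->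
  exists G : dist R,
    G (~` [set` s]) = 0%E /\ {in s, forall x, G [set x] = (c x)%:E}.
Proof.
move=> us c0 c1.
pose M : {measure set (measurableTypeR R) -> \bar R} :=
  (* the absolute value only serves to make the weight a nonnegative number *)
  msum (fun k => mscale (NngNum (normr_ge0 (c (nth 0 s k))))
    (@dirac _ (measurableTypeR R) (nth 0 s k) R)) (size s).
have ME A :
    M A = (\sum_(x <- s) (c x)%:E * @dirac _ (measurableTypeR R) x R A)%E.
  rewrite /M /= /msum [RHS](big_nth 0) big_mkord; apply: eq_bigr => k _.
  by rewrite -[in RHS](ger0_norm (c0 _ (mem_nth 0 (ltn_ord k)))).
have M1 : M setT = 1%E.
  rewrite ME -c1 -sumEFin; apply: eq_bigr => x _.
  by rewrite diracT mule1.
pose prob := Measure_isProbability.Build _ _ _ M M1.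
pose G : dist R := HB.pack (Measure.sort M) prob.
exists G; split=> [|x xs]; rewrite [LHS]ME.
  by rewrite big_seq big1// => x xs; rewrite diracE memNset ?mule0//.
rewrite (big_rem x)//= diracE mem_set// mule1 big_seq big1 ?adde0// => y.
rewrite mem_rem_uniq// inE => /andP[yx _].
by rewrite diracE memNset ?mule0//= => /eqP; apply/negP.
Qed.

Lemma mean_calA (R : realType) (P : dist R) : calA P ->
  -1 <= fine (mean P) <= 0.
Proof.
move=> PA; have [Pfin _] := PA; rewrite mean_mass//=; apply/andP; split.
  rewrite -[X in - X](mass_sum1 Pfin) -sumrN big_seq [leRHS]big_seq.
  apply: ler_sum => x xP; have := mass_gt0 Pfin xP.
  by have /andP[? _] := calA_atoms PA xP => ?; nra.
rewrite big_seq; apply: sumr_le0 => x xP; have := mass_gt0 Pfin xP.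
by have /andP[_ ?] := calA_atoms PA xP => ?; nra.
Qed.

Lemma discrete_law_calA (R : realType) (s : seq R) (c : R -> R) :
  uniq s -> {in s, forall x, 0 <= c x} -> \sum_(x <- s) c x = 1 ->
  {in s, forall x, -1 <= x <= 0} ->
  exists G : dist R, [/\ calA G, {in s, forall x, mass G x = c x} &
    mean G = (\sum_(x <- s) c x * x)%:E].
Proof.
move=> us c0 c1 sI; have [G [Gs Gc]] := discrete_law us c0 c1; exists G.
have sub : supp G `<=` [set` s].
  move=> x Gx; apply: contrapT => xs.
  have : open_nbhs x (~` [set` s]).
    split=> //; apply: closed_openC; move: [set` s] (finite_seq s).
    exact/accessible_finite_set_closed/hausdorff_accessible/Rhausdorff.
  by move=> /Gx; rewrite Gs ltxx.
split.
- split; first exact: sub_finite_set sub (finite_seq s).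
  by move=> x /sub /= /sI; rewrite in_itv.
- by move=> x xs; rewrite /mass Gc.
- rewrite /mean unlock (integral_seq us Gs); last exact/measurable_EFinP.
  by rewrite -sumEFin; apply: eq_big_seq => x xs; rewrite Gc.
Qed.

(** A competitor of mean exactly [m]: the optimal law for [mu], with masses [g x] and
    an atom [nu * H] at 0, reweighted by [1 + t * (x - mu)].  The reweighting keeps
    the total mass and moves the mean by [t] times the variance, which at a critical
    point is [(mu - E(F)) / nu]; this dictates the value of [t]. *)
Lemma KL_primal_bound (R : realType) (F : dist R) (mu nu m : R) :
  calA F -> fine (mean F) < mu -> mu < 0 ->
  dual_critical (atoms F) (mass F) mu nu ->
  let t := (m - mu) * nu / (mu - fine (mean F)) in `|t| <= 2^-1 ->
  exists G : dist R, [/\ calA G, mean G = m%:E &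
    (KL F G <= (dual_value (atoms F) (mass F) mu nu + nu * (m - mu)
                + 2 * t ^+ 2)%:E)%E].
Proof.
move=> FA Fmu mu0 crit t tle; have [Ffin _] := FA.
have [nu0 munu w0 H0 Hmu] := crit.
have /andP[F1 _] := mean_calA FA.
set d := mu - fine (mean F) in t tle *.
have d0 : 0 < d by rewrite /d subr_gt0.
have td : t * d = (m - mu) * nu by rewrite /t mulfVK// gt_eqF.
set H := slope (atoms F) (mass F) mu nu in H0 Hmu.
have p0 := mass_gt0 Ffin; have p1 := mass_sum1 Ffin.
have sI := calA_atoms FA.
have dE : d = mu - \sum_(x <- atoms F) mass F x * x by rewrite /d mean_mass.
pose g x := mass F x / tilt mu nu x.
have g0 : {in atoms F, forall x, 0 < g x}.
  by move=> x xF; rewrite divr_gt0 ?p0 ?w0.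
have u2 x : -1 <= x <= 0 -> `|t * (x - mu)| <= 2^-1.
  move=> /andP[x1 x0]; rewrite normrM -[leRHS]mulr1 ler_pM//.
  by rewrite ler_norml; apply/andP; split; lra.
have u1 x : -1 <= x <= 0 -> 0 < 1 + t * (x - mu).
  by move=> /u2; rewrite ler_norml => /andP[? _]; lra.
(* The masses are [a] on the atoms of [F], plus [e] at 0, which may or may not
   be one of these atoms. *)
pose a x := g x * (1 + t * (x - mu)).
pose e := nu * H * (1 - t * mu).
have e0 : 0 <= e.
  have := u1 0; rewrite sub0r mulrN lexx lerN10 => /(_ isT)/ltW.
  by apply: mulr_ge0; exact: mulr_ge0.
pose c x := (if x \in atoms F then a x else 0) + (if x == 0 then e else 0).
pose s := undup (0 :: atoms F).
have cE (f : R -> R) :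
    \sum_(x <- s) c x * f x = \sum_(x <- atoms F) a x * f x + e * f 0.
  have us : uniq s by exact: undup_uniq.
  transitivity (\sum_(x <- s | x \in atoms F) a x * f x +
                \sum_(x <- s | x \in [:: 0]) e * f x).
    rewrite [X in _ = X + _]big_mkcond [X in _ = _ + X]big_mkcond -big_split/=.
    apply: eq_bigr => x _; rewrite /c mulrDl inE.
    by case: ifP => _; case: ifP => _; rewrite ?mul0r.
  rewrite !sum_sub_uniq ?uniq_atoms ?big_seq1// => x.
    by rewrite inE mem_undup inE => ->.
  by rewrite mem_undup inE => ->; rewrite orbT.
have massg : \sum_(x <- atoms F) g x = 1 - nu * H by exact: tilted_mass.
have momg : \sum_(x <- atoms F) g x * (mu - x) = H.
  by apply: eq_bigr => x _; rewrite /g mulrAC.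
have varg : nu * \sum_(x <- atoms F) g x * (mu - x) ^+ 2 = d - H.
  by rewrite dE; exact: tilted_second_moment.
have [||||G [GA Gc Gm]] := @discrete_law_calA R s c.
- exact: undup_uniq.
- move=> x _; rewrite addr_ge0//; case: ifP => // xF.
  by rewrite /a mulr_ge0 ?ltW ?g0 ?u1 ?sI.
- transitivity (\sum_(x <- s) c x * 1); first by apply: eq_bigr => x; rewrite mulr1.
  rewrite cE; transitivity (\sum_(x <- atoms F) g x
      - t * \sum_(x <- atoms F) g x * (mu - x) + e).
    rewrite mulr1 mulr_sumr -sumrB; congr (_ + _); apply: eq_bigr => x _.
    by rewrite /a; ring.
  rewrite massg momg /e.
  have -> : 1 - nu * H - t * H + nu * H * (1 - t * mu) =
    1 - t * (H * (1 + mu * nu)) by ring.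
  by rewrite Hmu mulr0 subr0.
- by move=> x; rewrite mem_undup inE => /predU1P[->|/sI//]; rewrite lexx lerN10.
exists G; split=> //.
  rewrite Gm cE mulr0 addr0; congr EFin.
  transitivity (mu * \sum_(x <- atoms F) g x
      - (1 + t * mu) * \sum_(x <- atoms F) g x * (mu - x)
      + t * \sum_(x <- atoms F) g x * (mu - x) ^+ 2).
    rewrite !mulr_sumr -sumrB -big_split/=; apply: eq_bigr => x _.
    by rewrite /a; ring.
  rewrite massg momg.
  have -> : t * \sum_(x <- atoms F) g x * (mu - x) ^+ 2 =
      (m - mu) / d * (d - H).
    by rewrite -varg /t; field; rewrite gt_eqF.
  have -> : (1 + t * mu) * H = H + (m - mu) / d * (H * (1 + mu * nu) - H).
    by rewrite /t; field; rewrite gt_eqF.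
  have -> : mu * (1 - nu * H) = mu - (H * (1 + mu * nu) - H) by ring.
  by rewrite Hmu; field; rewrite gt_eqF.
(* if F charges 0 then 1 + mu * nu > 0, hence H = 0 and nothing is added at 0 *)
have cF : {in atoms F, forall x, mass G x = a x}.
  move=> x xF; rewrite Gc; last by rewrite mem_undup inE xF orbT.
  rewrite /c xF; case: eqP => [x0|_]; last by rewrite addr0.
  have := w0 _ xF; rewrite x0 /tilt sub0r mulNr opprK => /lt0r_neq0 mn.
  have : H * (1 + mu * nu) == 0 by rewrite Hmu.
  rewrite mulf_eq0 (negbTE mn) orbF => /eqP H00.
  by rewrite /e H00 mulr0 mul0r addr0.
have a0 : {in atoms F, forall x, 0 < a x}.
  by move=> x xF; rewrite mulr_gt0 ?g0 ?u1 ?sI.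
have [_ ->] : {in atoms F, forall x, 0 < mass G x} /\
    KL F G = (\sum_(x <- atoms F) mass F x * ln (mass F x / mass G x))%:E.
  apply: KL_mass => //; apply: dominates_mass => // x xF.
  by rewrite cF ?a0.
rewrite lee_fin.
(* - ln (1 + u) <= - u / (1 + u) <= - u + 2 * u ^ 2 for |u| <= 1 / 2 *)
apply: (@le_trans _ _ (\sum_(x <- atoms F) mass F x *
   (ln (tilt mu nu x) + t * (mu - x) + 2 * t ^+ 2))).
  rewrite big_seq [leRHS]big_seq; apply: ler_sum => x xF.
  have px := p0 _ xF; have wx := w0 _ xF; have ux := u1 _ (sI _ xF).
  have /u2 := sI _ xF; rewrite ler_norml => /andP[ux2 _].
  rewrite ler_pM2l// cF//.
  have -> : mass F x / a x = tilt mu nu x * (1 + t * (x - mu))^-1.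
    by rewrite /a /g; field; rewrite !gt_eqF.
  rewrite lnM ?posrE ?invr_gt0// -addrA lerD2l.
  apply: le_trans (ln_le_sub1 _) _; first by rewrite invr_gt0.
  have -> : (1 + t * (x - mu))^-1 - 1 =
    t * (mu - x) + (t * (x - mu)) ^+ 2 / (1 + t * (x - mu)).
    by field; rewrite gt_eqF.
  rewrite lerD2l ler_pdivrMr//.
  have /andP[x1 x0] := sI _ xF.
  have y2 : (x - mu) ^+ 2 <= 1 by nra.
  have t2 : 0 <= t ^+ 2 by exact: sqr_ge0.
  rewrite exprMn; apply: (@le_trans _ _ (t ^+ 2)); first by nra.
  by nra.
rewrite le_eqVlt; apply/orP; left; apply/eqP.
transitivity (dual_value (atoms F) (mass F) mu nu
   + t * (mu * \sum_(x <- atoms F) mass F x - \sum_(x <- atoms F) mass F x * x)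
   + 2 * t ^+ 2 * \sum_(x <- atoms F) mass F x).
  rewrite /dual_value mulrBr !mulr_sumr -sumrB -!big_split/=.
  by apply: eq_bigr => x _; ring.
by rewrite p1 !mulr1 -dE td mulrC [nu * _]mulrC mulrC.
Qed.

(** * The minimal divergence *)

Lemma is_derive_quadratic (R : realType) (f : R -> R) (a l C e : R) :
  0 < e -> 0 <= C ->
  (forall x, `|x - a| < e -> `|f x - f a - l * (x - a)| <= C * (x - a) ^+ 2) ->
  is_derive a 1 f l.
Proof.
move=> e0 C0 fC.
suff cv : (fun h => h^-1 *: ((f \o shift a) (h *: (1 : R)) - f a)) @ 0^' --> l.
  by apply: DeriveDef; [apply/cvg_ex; exists l|exact: cvg_lim].
apply/cvgrPdist_le => eps eps0; near=> h.
have h0 : h != 0 by near: h; exact: nbhs_dnbhs_neq.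
have he : `|h| < e by near: h; exact: dnbhs0_lt.
have hC : `|h| < eps / (C + 1).
  by near: h; apply: dnbhs0_lt; rewrite divr_gt0// ltr_wpDl.
have := fC (h + a); rewrite addrK => /(_ he) fh.
rewrite /= [h *: _]mulr1 distrC.
have -> : h^-1 *: (f (h + a) - f a) - l = h^-1 * (f (h + a) - f a - l * h).
  by rewrite /GRing.scale /=; field.
rewrite normrM normfV ler_pdivrMl ?normr_gt0//.
apply: le_trans fh _; rewrite -real_normK ?num_real//.
move: hC; rewrite ltr_pdivlMr ?ltr_wpDl// => hC.
have hp : 0 < `|h| by rewrite normr_gt0.
by nra.
Unshelve. all: by end_near. Qed.

Lemma measurable_invr (R : realType) :
  measurable_fun setT (fun x : R => x^-1).
Proof.
rewrite -(setUv [set (0 : R)]); apply/measurable_funU => //.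
  exact: measurableC.
split; first exact: measurable_fun_set1.
apply: subspace_continuous_measurable_fun; first exact: measurableC.
apply: continuous_in_subspaceT => x; rewrite inE => /eqP x0.
exact: inv_continuous.
Qed.

Section minimization.
Variables (R : realType) (F : dist R) (mu : R).
Hypothesis FA : calA F.
Hypothesis Fmu : fine (mean F) < mu.
Hypothesis mu0 : mu < 0.

Let Ffin : finite_set (supp F). Proof. by case: FA. Qed.

Local Notation V nu := (dual_value (atoms F) (mass F) mu nu).
Local Notation critical nu := (dual_critical (atoms F) (mass F) mu nu).
Local Notation H nu := (slope (atoms F) (mass F) mu nu).

Lemma mean_fin (G : dist R) : calA G -> mean G = (fine (mean G))%:E.
Proof. by move=> [Gfin _]; rewrite mean_mass. Qed.

Lemma Dmin_ge nu m : critical nu -> ((V nu + nu * (m - mu))%:E <= Dmin F m)%E.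
Proof.
move=> [nu0 munu w0 _ _]; apply: le_ereal_inf_tmp => _ [G [GA mG] <-].
apply: le_trans (KL_dual_bound FA GA nu0 munu w0).
by rewrite lee_fin lerD2l ler_wpM2l// lerD2r -lee_fin -mean_fin.
Qed.

Lemma Dmin_le nu m : critical nu ->
  let t := (m - mu) * nu / (mu - fine (mean F)) in `|t| <= 2^-1 ->
  (Dmin F m <= (V nu + nu * (m - mu) + 2 * t ^+ 2)%:E)%E.
Proof.
move=> crit t tle.
have [G [GA Gm]] := KL_primal_bound FA Fmu mu0 crit tle.
by apply: le_trans; apply: ereal_inf_lbound; exists G => //; split; rewrite ?Gm.
Qed.

Lemma Dmin_attained nu : critical nu ->
  Dmin F mu = (V nu)%:E /\
  exists G : dist R, [/\ calA G, (mu%:E <= mean G)%E & KL F G = Dmin F mu].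
Proof.
move=> crit.
have t0 : `|(mu - mu) * nu / (mu - fine (mean F))| <= 2^-1.
  by rewrite subrr !mul0r normr0 invr_ge0.
have [G [GA Gm]] := KL_primal_bound FA Fmu mu0 crit t0.
have := @Dmin_ge nu mu crit; rewrite !subrr !mul0r !mulr0 expr0n mulr0 !addr0.
move=> Dge KLle.
have GD : (Dmin F mu <= KL F G)%E.
  by apply: ereal_inf_lbound; exists G => //; split; rewrite ?Gm.
have DE : Dmin F mu = (V nu)%:E.
  by apply/eqP; rewrite eq_le Dge (le_trans GD KLle).
split=> //; exists G; split=> //; first by rewrite Gm.
by apply/eqP; rewrite eq_le GD DE KLle.
Qed.

(** [Dmin F m] lies between the line of slope [nu] through [(mu, Dmin F mu)] and this
    line plus a quadratic term. *)
Lemma Dmin_derive nu : critical nu ->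
  is_derive mu 1 (fun m : R => fine (Dmin F m)) nu.
Proof.
move=> crit; have [nu0 _ _ _ _] := crit; have [DE _] := Dmin_attained crit.
set d := mu - fine (mean F); have d0 : 0 < d by rewrite subr_gt0.
pose e := d / (2 * (nu + 1)).
have e0 : 0 < e by rewrite divr_gt0// mulr_gt0// ltr_wpDl.
apply: (@is_derive_quadratic _ _ _ _ (2 * (nu / d) ^+ 2) e) => //.
  by rewrite mulr_ge0// sqr_ge0.
move=> m me.
(* e is chosen so that t stays in the range of the primal bound *)
have tle : `|(m - mu) * nu / d| <= 2^-1.
  rewrite -mulrA normrM (ger0_norm (divr_ge0 nu0 (ltW d0))).
  apply: (@le_trans _ _ (e * (nu / d))).
    by rewrite ler_wpM2r ?divr_ge0// ltW.
  have -> : e * (nu / d) = 2^-1 * (nu / (nu + 1)).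
    by rewrite /e; field; rewrite !gt_eqF// ltr_wpDl.
  by rewrite -[leRHS]mulr1 ler_wpM2l// ler_pdivrMr ?ltr_wpDl// mul1r lerDl.
have lo := @Dmin_ge nu m crit.
have up := @Dmin_le nu m crit tle.
have DmE : Dmin F m = (fine (Dmin F m))%:E.
  rewrite fineK//; apply: fin_real.
  by rewrite (lt_le_trans _ lo) ?ltNyr// (le_lt_trans up) ?ltry.
rewrite DmE !lee_fin in lo up; rewrite DE /=.
set D := fine (Dmin F m) in lo up *.
rewrite ger0_norm; last by rewrite -addrA -opprD subr_ge0.
have -> : 2 * (nu / d) ^+ 2 * (m - mu) ^+ 2 = 2 * ((m - mu) * nu / d) ^+ 2.
  by rewrite !exprMn; ring.
by rewrite -addrA -opprD lerBlDl.
Qed.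

Lemma atom_neq_mu : exists2 x, x \in atoms F & x != mu.
Proof.
apply: contrapT => nex; move: Fmu; rewrite mean_mass//= ltNge => /negP; apply.
rewrite -[leLHS]mulr1 -(mass_sum1 Ffin) mulr_sumr le_eqVlt; apply/orP; left.
apply/eqP/eq_big_seq => x xF; have [->|xmu] := eqVneq x mu.
  by rewrite mulrC.
by exfalso; apply: nex; exists x.
Qed.

Lemma h_critical nu : critical nu -> h F mu nu = (V nu)%:E.
Proof. by move=> [_ _ w0 _ _]; exact: h_mass. Qed.

(** The condition on [nu'] covers both optimization problems: it holds on the whole
    of [0, -1/mu] by complementarity ([critical_slope_le]), and for every [nu'] when
    the slope vanishes. *)
Lemma h_le_critical nu nu' : critical nu -> H nu * (nu' - nu) <= 0 ->
  (h F mu nu' <= h F mu nu)%E.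
Proof.
move=> crit Hle; have [_ _ w0 _ _] := crit.
rewrite (h_critical crit).
have [w0'|/h_Ny -> //] := pselect {in atoms F, forall x, 0 < tilt mu nu' x};
  last by rewrite leNye.
rewrite h_mass// lee_fin.
have := dual_value_tangent (mass_gt0 Ffin) w0 w0'.
by move=> /le_trans; apply; rewrite gerDl.
Qed.

Lemma h_ge_critical nu nu' : critical nu -> H nu * (nu' - nu) <= 0 ->
  (h F mu nu <= h F mu nu')%E -> nu' = nu.
Proof.
move=> crit Hle; have [_ _ w0 _ _] := crit.
rewrite (h_critical crit).
have [w0'|/h_Ny ->//] := pselect {in atoms F, forall x, 0 < tilt mu nu' x}.
rewrite h_mass// lee_fin => le; apply/eqP/contraT => nn.
have [x xF xmu] := atom_neq_mu.
have := dual_value_strict (mass_gt0 Ffin) xF xmu nn w0 w0'.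
move=> /(le_lt_trans le); rewrite ltrDl => /lt_le_trans/(_ Hle).
by rewrite ltxx.
Qed.

Lemma le_invN nu : (nu <= - 1 / mu) = (0 <= 1 + mu * nu).
Proof. by rewrite ler_ndivlMr// mulrC -lerBlDl sub0r. Qed.

Lemma critical_slope_le nu nu' : critical nu -> nu' <= - 1 / mu ->
  H nu * (nu' - nu) <= 0.
Proof.
move=> [_ _ _ H0 Hmu]; rewrite le_invN => nu1.
rewrite -(nmulr_rge0 _ mu0).
have -> : mu * (H nu * (nu' - nu)) = H nu * (1 + mu * nu') - H nu * (1 + mu * nu).
  by ring.
by rewrite Hmu subr0 mulr_ge0.
Qed.

Lemma argmax_critical nu : critical nu ->
  is_argmax `[0, - 1 / mu] (h F mu) nu.
Proof.
move=> crit; have [nu0 nu1 _ _ _] := crit; split.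
  by rewrite /= in_itv /= nu0 le_invN.
move=> nu'; rewrite /= in_itv /= => /andP[_ nu1'].
exact/h_le_critical/critical_slope_le.
Qed.

Lemma argmax_unique nu nu' : critical nu ->
  is_argmax `[0, - 1 / mu] (h F mu) nu' -> nu' = nu.
Proof.
move=> crit [+ max']; rewrite /= in_itv /= => /andP[_ nu1'].
apply: h_ge_critical => //; first exact: critical_slope_le.
by apply: max'; have [] := argmax_critical crit.
Qed.

Section no_atom_at_0.
Hypothesis F0 : 0 \notin atoms F.

Let F_neq0 x : x \in atoms F -> x != 0.
Proof. by move=> xF; apply: contraNneq F0 => <-. Qed.

Lemma tilt_invN x : tilt mu (- 1 / mu) x = x / mu.
Proof. by rewrite /tilt; field; rewrite lt_eqF. Qed.

Lemma tilt_invN_gt0 : {in atoms F, forall x, 0 < tilt mu (- 1 / mu) x}.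
Proof.
move=> x xF; rewrite tilt_invN nmulr_lgt0 ?invr_lt0//.
by rewrite lt_neqAle F_neq0//; have /andP[] := calA_atoms FA xF.
Qed.

(** At [nu = -1/mu] the sign of the slope is decided by [E[mu/X]]. *)
Lemma slope_invN :
  H (- 1 / mu) = mu * (\sum_(x <- atoms F) mass F x * (mu / x) - 1).
Proof.
transitivity (mu * (\sum_(x <- atoms F) mass F x * (mu / x) -
                    \sum_(x <- atoms F) mass F x)); last by rewrite mass_sum1.
rewrite -sumrB mulr_sumr; apply: eq_big_seq => x xF.
by rewrite tilt_invN; field; rewrite F_neq0// lt_eqF.
Qed.

Lemma mean_inv_mass :
  mean_inv F mu = (\sum_(x <- atoms F) mass F x * (mu / x))%:E.
Proof.
rewrite /mean_inv; case: ifPn => [/gt0_supp/(atomsP Ffin)|_].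
  by rewrite (negbTE F0).
rewrite unlock integral_mass//.
apply: measurable_funM; first exact: measurable_cst.
exact: measurable_invr.
Qed.

Lemma critical_invN : (mean_inv F mu <= 1)%E -> critical (- 1 / mu).
Proof.
rewrite mean_inv_mass lee_fin => F1.
have E : 1 + mu * (- 1 / mu) = 0 by field; rewrite lt_eqF.
split; [|by rewrite E|exact: tilt_invN_gt0| |by rewrite E mulr0].
  by rewrite mulN1r oppr_ge0 invr_le0 ltW.
by rewrite slope_invN mulr_le0 ?subr_le0// ltW.
Qed.

Lemma h_invN : h F mu (- 1 / mu) =
  (\sum_(x \in supp F `\ 0%R) F [set x] * lne (x / mu)%:E)%E.
Proof.
have -> : supp F `\ 0 = supp F.
  apply/seteqP; split=> [x []//|x Fx]; split=> // x0.
  by move: F0; rewrite -x0 => /negP; apply; apply/(atomsP Ffin).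
rewrite fsbig_finite// (h_mass Ffin tilt_invN_gt0) -sumEFin.
apply: eq_big_seq => x xF; have := tilt_invN_gt0 xF.
by rewrite tilt_invN => ?; rewrite massE lne_EFin.
Qed.

End no_atom_at_0.

Lemma mean_inv_le1 : (mean_inv F mu <= 1)%E -> 0 \notin atoms F.
Proof.
by apply: contraTN => /(atom_gt0 Ffin) F0; rewrite /mean_inv F0 leye_eq.
Qed.

(** By complementarity a positive slope would force [nu = -1/mu], where the slope is
    [mu * (E[mu/X] - 1) <= 0]. *)
Lemma critical_slope_eq0 nu : critical nu -> (1 <= mean_inv F mu)%E ->
  H nu = 0.
Proof.
move=> [_ _ w0 H0 /eqP]; rewrite mulf_eq0 => /orP[/eqP//|/eqP E].
have nuE : nu = - 1 / mu.
  transitivity ((1 + mu * nu) / mu - 1 / mu).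
    by field; rewrite lt_eqF.
  by rewrite E mul0r sub0r mulNr.
have F0 : 0 \notin atoms F.
  by apply/negP => /w0; rewrite /tilt sub0r mulNr opprK E ltxx.
rewrite (mean_inv_mass F0) lee_fin => F1; apply/eqP; rewrite eq_le H0 andbT.
by rewrite nuE slope_invN// mulr_le0_ge0 ?subr_ge0// ltW.
Qed.

End minimization.

Theorem theorem5 (R : realType) (F : dist R) (mu : R)
  (FA : calA F) (Fmu : (mean F < mu%:E)%E) (mu0 : mu < 0) :
  (* D_min is a minimum *)
  (exists G : dist R,
     [/\ calA G, (mu%:E <= mean G)%E & KL F G = Dmin F mu]) /\
  exists nu : R,
  [/\ (* (i) *)
      [/\ is_argmax `[0, - 1 / mu] (h F mu) nu,
          (forall nu', is_argmax `[0, - 1 / mu] (h F mu) nu' -> nu' = nu),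
          Dmin F mu = h F mu nu,
          ((mean_inv F mu <= 1)%E ->
             [/\ nu = - 1 / mu,
                 Dmin F mu = h F mu (- 1 / mu) &
                 h F mu (- 1 / mu) =
                   (\sum_(x \in supp F `\ 0%R)
                      F [set x] * lne (x / mu)%:E)%E]) &
          ((1 <= mean_inv F mu)%E ->
             exists2 nu0, is_argmax setT (h F mu) nu0 &
                          Dmin F mu = h F mu nu0)],
      (* (ii) *)
      (mu - fine (mean F)) / (- mu * (1 + mu)) <= nu &
      (* (iii) *)
      Dmin F mu \is a fin_num /\
      is_derive mu 1 (fun m : R => fine (Dmin F m)) nu].
Proof.
have Ffin : finite_set (supp F) by case: FA.
have {}Fmu : fine (mean F) < mu by rewrite -lte_fin -mean_fin.
have mF : fine (mean F) = \sum_(x <- atoms F) mass F x * x by rewrite mean_mass.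
have [nu crit] : exists nu, dual_critical (atoms F) (mass F) mu nu.
  apply: critical_exists => //; [exact: mass_gt0|exact: mass_sum1| |].
  - exact: calA_atoms.
  - by rewrite -mF.
have [DE Dex] := Dmin_attained FA Fmu mu0 crit.
have hE := h_critical FA crit.
split=> //; exists nu; split.
- split; [exact: argmax_critical| |by rewrite hE| |].
  + by move=> nu'; exact: (argmax_unique FA Fmu mu0 crit).
  + move=> F1; have F0 := mean_inv_le1 FA F1.
    have nuE : - 1 / mu = nu.
      apply: (argmax_unique FA Fmu mu0 crit).
      exact/(argmax_critical FA mu0)/(critical_invN FA mu0 F0 F1).
    by rewrite -(h_invN FA mu0 F0) nuE DE hE.
  + move=> F1; exists nu; last by rewrite hE.
    split=> // nu' _; apply: h_le_critical => //.
    by rewrite critical_slope_eq0// mul0r.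
- have /andP[mF1 _] := mean_calA FA.
  rewrite ler_pdivrMr; last by rewrite mulr_gt0; lra.
  rewrite mF; apply: critical_lower_bound crit => //.
  + exact: mass_gt0.
  + exact: mass_sum1.
  + exact: calA_atoms.
- by rewrite DE; split=> //; exact: Dmin_derive.
Qed.
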